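(* Let $p$ be an $\mathrm{evenlevel}(v)$ path or an $\mathrm{oddlevel}(v)$ path starting at an unmatched vertex $f$, and let $u$ be a vertex on $p$ with $\mathrm{t}(u)\ge \mathrm{t}(v)$. Then $u$ is BFS-honest with respect to $p$. Furthermore, if $\mathrm{t}(u)>\mathrm{t}(v)$ then $|p[f \text{ to } u]|=\mathrm{minlevel}(u)$.
   Context: $G=(V,E)$ is a finite undirected graph and $M$ a matching; edges in $M$ are matched, others unmatched; a vertex is unmatched if no matched edge is incident to it. An alternating path is a simple path whose edges alternate between matched and unmatched. $\mathrm{evenlevel}(v)$ ($\mathrm{oddlevel}(v)$) is the length of a minimum even (odd) length alternating path from some unmatched vertex to $v$ ($\infty$ if none); such a path is called an $\mathrm{evenlevel}(v)$ ($\mathrm{oddlevel}(v)$) path. $\mathrm{minlevel}(v)$ is the smaller of the two. Tenacity $\mathrm{t}(v)=\mathrm{evenlevel}(v)+\mathrm{oddlevel}(v)$. For $u$ on a path $p$ starting at $f$, $p[f\text{ to }u]$ is the subpath from $f$ to $u$ and $|\cdot|$ its length; $u$ is even (odd) w.r.t. $p$ if this length is even (odd), and $u$ is BFS-honest w.r.t. $p$ if $|p[f\text{ to }u]|=\mathrm{evenlevel}(u)$ when $u$ is even w.r.t. $p$, and $=\mathrm{oddlevel}(u)$ when $u$ is odd w.r.t. $p$. *)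

(* Defs.v *)
From HB Require Import structures.
From mathcomp Require Import all_boot.

Set Implicit Arguments.
Unset Strict Implicit.
Unset Printing Implicit Defensive.

(* Levels and tenacities live in nat with an added infinity, encoded as None. *)
Definition enat := option nat.

Definition enat_add (a b : enat) : enat :=
  if (a, b) is (Some m, Some n) then Some (m + n) else None.

Definition enat_le (a b : enat) : bool :=
  match a, b with
  | _, None => true
  | None, Some _ => false
  | Some m, Some n => m <= n
  end.

Definition enat_lt (a b : enat) : bool := ~~ enat_le b a.

Definition enat_min (a b : enat) : enat := if enat_le a b then a else b.

Section Matching.

Variable V : finType.
Implicit Types (E M : {set {set V}}) (f u v : V) (p : seq V).

Definition simple_graph E : Prop := forall e, e \in E -> #|e| = 2.

Definition matching E M : Prop := M \subset E /\ trivIset M.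

Definition unmatched M v : bool := v \notin cover M.

(* A path starting at f is represented by f and the sequence p of its
   subsequent vertices; hence its length is size p and its end is last f p. *)
Definition path_edges f p : seq {set V} :=
  pairmap (fun x y => [set x; y]) f p.

Definition alternating_path E M f p : bool :=
  [&& uniq (f :: p),
      all (fun e => e \in E) (path_edges f p)
    & sorted (fun e1 e2 => (e1 \in M) != (e2 \in M)) (path_edges f p)].

Definition alternating_path_to E M v f p : bool :=
  [&& unmatched M f, alternating_path E M f p & last f p == v].

(* The least length of parity b (true for odd) of an alternating path from an
   unmatched vertex to v. Simple paths have length less than #|V|, so it is
   enough to search below that bound; see levelP. *)
Definition level E M (b : bool) v : enat :=
  ohead [seq n <- iota 0 #|V| | (odd n == b) &&
    [exists f : V, exists p : n.-tuple V, alternating_path_to E M v f p]].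

Definition evenlevel E M v : enat := level E M false v.

Definition oddlevel E M v : enat := level E M true v.

Definition minlevel E M v : enat := enat_min (evenlevel E M v) (oddlevel E M v).

Definition tenacity E M v : enat := enat_add (evenlevel E M v) (oddlevel E M v).

Definition evenlevel_path E M v f p : Prop :=
  [/\ alternating_path_to E M v f p, ~~ odd (size p)
    & evenlevel E M v = Some (size p)].

Definition oddlevel_path E M v f p : Prop :=
  [/\ alternating_path_to E M v f p, odd (size p)
    & oddlevel E M v = Some (size p)].

(* The length of p[f to u], for u on the (simple) path f :: p. *)
Definition prefix_length f p u : nat := index u (f :: p).

Definition BFS_honest E M f p u : Prop :=
  if odd (prefix_length f p u) then oddlevel E M u = Some (prefix_length f p u)
  else evenlevel E M u = Some (prefix_length f p u).

Lemma levelP E M (b : bool) v :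
  match level E M b v with
  | Some n =>
      [/\ odd n = b,
          exists f, exists2 p, alternating_path_to E M v f p & size p = n
        & forall f p, alternating_path_to E M v f p -> odd (size p) = b ->
            n <= size p]
  | None => forall f p, alternating_path_to E M v f p -> odd (size p) <> b
  end.
Proof.
rewrite /level; set P := fun n => (_ == b) && _.
have P_path f p : alternating_path_to E M v f p -> odd (size p) = b ->
    size p \in [seq n <- iota 0 #|V| | P n].
  move=> pP pb; rewrite mem_filter mem_iota /= /P pb eqxx /=; apply/andP; split.
    by apply/existsP; exists f; apply/existsP; exists (in_tuple p).
  case/and3P: pP => _ /and3P[/card_uniqP Up _ _] _.
  by rewrite add0n -[(size p).+1]/(size (f :: p)) -Up max_card.
have: sorted ltn [seq n <- iota 0 #|V| | P n].
  by rewrite sorted_filter ?iota_ltn_sorted //; apply: ltn_trans.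
case Es: [seq n <- iota 0 #|V| | P n] => [|n s] /=.
  by move=> _ f p /P_path pP /pP; rewrite Es.
move=> /(order_path_min ltn_trans) /allP lt_n.
have: n \in [seq n <- iota 0 #|V| | P n] by rewrite Es mem_head.
rewrite mem_filter => /andP[/andP[/eqP nb /existsP[f /existsP[p pP]]] _].
split=> [//||g q /P_path qP /qP]; first by exists f, p; rewrite ?size_tuple.
by rewrite Es inE => /predU1P[-> //|/lt_n /ltnW].
Qed.

End Matching.

(* Main.v *)
Require Import Defs.
From mathcomp Require Import all_boot.
From mathcomp Require Import zify.

(** Write [n = |p|] and [i = |p[f to u]|].  Follow any alternating path [r] from
    an unmatched vertex to a vertex of [p[u to v]], up to the first vertex [x] it
    shares with [p[u to v]].  If [x] has the same parity on [r] and [p], then [r]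
    up to [x] continues along [p] to [v], and minimality of [p] forces
    [i <= |r|].  Otherwise it continues backwards along [p] to [u], which bounds
    the level of [u] of parity opposite to [i] by [|r| + n - i].  Both claims
    follow by taking for [r] a minimum path to [u] of the parity of [i], and a
    minimum path to [v] of the parity opposite to [n]. *)

Section AlternatingPaths.

Set Implicit Arguments.
Unset Strict Implicit.

Variables (V : finType) (E M : {set {set V}}).
Implicit Types (f g u v w x y : V) (p q r s : seq V) (b : bool).

(* [b] tells whether the first edge is matched. *)
Fixpoint alternates b x s : bool :=
  if s is y :: s' then
    [&& [set x; y] \in E, ([set x; y] \in M) == b & alternates (~~ b) y s']
  else true.

Lemma alternates_cat b x s t :
  alternates b x (s ++ t)
  = alternates b x s && alternates (b (+) odd (size s)) (last x s) t.
Proof.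
elim: s b x => [|y s IHs] b x /=; first by rewrite addbF.
by rewrite IHs addNb addbN !andbA.
Qed.

(** The reversed path starts with the last edge of [s], whose status is [b] flipped once for each of
    the [size s - 1] preceding edges. *)
Lemma alternates_rev b x s :
  alternates b x s ->
  alternates (~~ (b (+) odd (size s))) (last x s) (rev (belast x s)).
Proof.
elim: s b x => [|y s IHs] b x //= /and3P[xyE xyM /IHs s_alt].
rewrite rev_cons -cats1 alternates_cat addbN -addNb s_alt size_rev size_belast.
have -> : last (last y s) (rev (belast y s)) = y.
  by case: (s) => //= z s'; rewrite rev_cons last_rcons.
by rewrite /= setUC xyE (eqP xyM) /=; case: b (odd _) {xyM s_alt} => [] [].
Qed.

Lemma alternatesE b x y s :
  alternates b x (y :: s)
  = [&& ([set x; y] \in M) == b,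
        all (fun e => e \in E) (path_edges x (y :: s))
      & sorted (fun e1 e2 => (e1 \in M) != (e2 \in M)) (path_edges x (y :: s))].
Proof.
elim: s b x y => [|z s IHs] b x y.
  by rewrite /= !andbT andbC.
rewrite [LHS]/= -/(alternates (~~ b) y (z :: s)) IHs /=.
case: (_ \in E); case: (_ \in M); case: (_ \in M); case: b => //=;
  by rewrite ?andbF.
Qed.

(** No edge at the unmatched vertex [f] lies in [M], so the parity of a position alone decides
    whether the next edge is matched. This allows paths to be recombined by parity. *)
Lemma alternating_path_toE v f p :
  alternating_path_to E M v f p
  = [&& unmatched M f, uniq (f :: p), alternates false f p & last f p == v].
Proof.
rewrite /alternating_path_to /alternating_path -!andbA.
case fU: (unmatched M f) => //=; case: p => [|y s] //.
rewrite alternatesE.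
suff /negPf -> : [set f; y] \notin M by rewrite -!andbA.
apply: contraL fU => fyM; rewrite negbK.
by apply/bigcupP; exists [set f; y]; rewrite ?set21.
Qed.

Lemma level_le v f p :
  alternating_path_to E M v f p ->
  exists2 m, level E M (odd (size p)) v = Some m & m <= size p.
Proof.
move=> pP; have := levelP E M (odd (size p)) v.
case: level => [m [_ _ min_m]|no_p]; first by exists m; last exact: min_m pP _.
by case: (no_p f p pP).
Qed.

Lemma level_ex b v m :
  level E M b v = Some m ->
  exists f, exists2 p, alternating_path_to E M v f p & size p = m.
Proof. by move=> Lm; have := levelP E M b v; rewrite Lm => -[]. Qed.

Lemma tenacityE b v :
  tenacity E M v = enat_add (level E M b v) (level E M (~~ b) v).
Proof.
rewrite /tenacity /evenlevel /oddlevel; case: b => //=.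
by case: level => [m|]; case: level => [n|] //; rewrite /enat_add addnC.
Qed.

Lemma split_first (A : {pred V}) g r :
  last g r \in A ->
  exists r1 r2, [/\ r = r1 ++ r2, last g r1 \in A & ~~ has A (belast g r1)].
Proof.
elim: r g => [|y r IHr] g /=; first by exists [::], [::].
case gA: (g \in A); first by exists [::], (y :: r).
case/IHr=> r1 [r2 [-> r1A r1N]]; exists (y :: r1), r2; split=> //=.
by rewrite negb_or r1N andbT; apply/negbT.
Qed.

Lemma level_first_meeting v f p1 p2 w g r (n := size (p1 ++ p2)) :
    alternating_path_to E M v f (p1 ++ p2) -> level E M (odd n) v = Some n ->
    alternating_path_to E M w g r -> w \in last f p1 :: p2 ->
  size p1 <= size r \/
  exists2 m, level E M (~~ odd (size p1)) (last f p1) = Some m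
           & m + size p1 <= size r + n.
Proof.
rewrite {}/n; set u := last f p1.
move=> pP p_min; rewrite alternating_path_toE => /and4P[gU Ur r_alt /eqP <-].
case/split_first=> r1 [r2 [Er]]; set x := last g r1 => x_p2 r1_p2.
have [fU Up p_alt /eqP Ev] : [/\ unmatched M f, uniq (f :: p1 ++ p2),
    alternates false f (p1 ++ p2) & last f (p1 ++ p2) == v].
  by move: pP; rewrite alternating_path_toE => /and4P.
have {fU Up} Up2 : uniq (u :: p2).
  move: Up; rewrite -cat_cons lastI cat_rcons cat_uniq -/u.
  by case/and3P.
move: p_alt; rewrite alternates_cat -/u => /andP[_ p2_alt].
have [Ur1 r1_alt] : uniq (g :: r1) /\ alternates false g r1.
  move: Ur r_alt; rewrite Er -cat_cons cat_uniq alternates_cat.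
  by case/and3P=> -> _ _ /andP[-> _].
(* Before [x], [r1] avoids [u :: p2], so any simple continuation inside [u :: p2] stays simple.
   Crossings of [r1] with [p1] are harmless, since [p1] is dropped. *)
have Ur1_cat s : {subset s <= u :: p2} -> uniq (x :: s) -> uniq (g :: r1 ++ s).
  move=> s_p2 Uxs; rewrite -cat_cons lastI cat_rcons cat_uniq Uxs andbT.
  move: Ur1; rewrite lastI rcons_uniq => /andP[_ ->]; rewrite andTb.
  apply: contra r1_p2 => /hasP[y y_s y_r1]; apply/hasP; exists y => //.
  by move: y_s; rewrite inE => /predU1P[-> // |/s_p2].
case/splitPl: p2 / x_p2 => s1 s2 Ex in Ur1_cat Up2 p2_alt Ev p_min pP r1_p2 *.
move: p2_alt; rewrite alternates_cat Ex => /andP[s1_alt s2_alt].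
have Uxs2 : uniq (x :: s2).
  move: Up2; rewrite -cat_cons lastI cat_rcons cat_uniq Ex.
  by case/and3P.
have [Epar|Npar] := eqVneq (odd (size r1)) (odd (size (p1 ++ s1))).
  left; have r1s2P : alternating_path_to E M v g (r1 ++ s2).
    rewrite alternating_path_toE gU Ur1_cat //; last first.
      by move=> y ys2; rewrite inE mem_cat ys2 !orbT.
    rewrite alternates_cat r1_alt -/x Epar size_cat oddD s2_alt /=.
    by rewrite -Ev !last_cat -/x -/u Ex.
  (* The new path to [v] has the parity of [n], so minimality gives
     [size p1 + size s1 <= size r1]. *)
  have [m] := level_le r1s2P; rewrite size_cat oddD Epar -oddD.
  have -> : odd (size (p1 ++ s1) + size s2) = odd (size (p1 ++ s1 ++ s2)).
    by rewrite catA [size ((p1 ++ s1) ++ s2)]size_cat.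
  rewrite p_min => -[<-]; rewrite Er !size_cat; lia.
right; have r1s1P : alternating_path_to E M u g (r1 ++ rev (belast u s1)).
  rewrite alternating_path_toE gU alternates_cat r1_alt -/x addFb.
  have -> : odd (size r1) = ~~ (odd (size p1) (+) odd (size s1)).
    by move: Npar; rewrite size_cat oddD; case: odd (_ (+) _) => [] [].
  have := alternates_rev s1_alt; rewrite Ex => ->; rewrite Ur1_cat /=.
  - rewrite last_cat -/x -Ex; case: (s1) => [|y s] //=.
    by rewrite rev_cons last_rcons.
  - move=> y; rewrite mem_rev => /mem_belast.
    by rewrite !inE mem_cat => /predU1P[->|->]; rewrite ?eqxx ?orbT.
  move: Up2; rewrite -cat_cons cat_uniq => /and3P[Us1 _ _].
  by rewrite mem_rev rev_uniq -Ex -rcons_uniq -lastI.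
(* As [r1] and [p1 ++ s1] differ in parity, adding [size s1] to [size r1] gives the parity opposite
   to [size p1]. *)
have [m Lm le_m] := level_le r1s1P; exists m.
  rewrite -Lm; congr (level _ _ _ _); rewrite size_cat size_rev size_belast.
  by move: Npar; rewrite size_cat !oddD; do 3!case: odd.
by move: le_m; rewrite Er !size_cat size_rev size_belast; lia.
Qed.

Lemma level_path_prefix v f p1 p2 (n := size (p1 ++ p2)) (u := last f p1) :
    alternating_path_to E M v f (p1 ++ p2) -> level E M (odd n) v = Some n ->
    enat_le (tenacity E M v) (tenacity E M u) ->
  level E M (odd (size p1)) u = Some (size p1).
Proof.
move=> pP p_min.
have [l Ll le_l] : exists2 l,
    level E M (odd (size p1)) u = Some l & l <= size p1.
  apply: (@level_le _ f); move: pP; rewrite !alternating_path_toE -cat_cons.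
  by rewrite cat_uniq alternates_cat eqxx => /and4P[-> /and3P[-> _ _] /andP[->]].
move: le_l Ll; rewrite leq_eqVlt => /predU1P[-> // |lt_l Ll].
have [g [q qP Eq]] := level_ex Ll.
(* A shorter path [q] to [u] excludes the first alternative; the second gives
   [m + size p1 <= l + n]. *)
case: (level_first_meeting pP p_min qP) => [||[m Lm le_m]].
- exact: mem_head.
- by rewrite Eq leqNgt lt_l.
rewrite (tenacityE (odd (size p1)) u) Ll Lm (tenacityE (odd n)) p_min.
case Lr: (level E M (~~ odd n) v) => [k|] //=.
have [h [r rP Er]] := level_ex Lr.
have v_p2 : v \in u :: p2.
  move: pP; rewrite alternating_path_toE last_cat => /and4P[_ _ _ /eqP <-].
  exact: mem_last.
(* If [size p1 <= k], then [l + m <= 2 * l + n - size p1 < n + k]; otherwise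
   [l + m < size p1 + m <= n + k]. Both contradict the tenacity hypothesis. *)
case: (level_first_meeting pP p_min rP v_p2) => [le_r|[m']].
  by move: le_m; rewrite -/n; lia.
by rewrite -/u Lm => -[<-]; rewrite -/n; lia.
Qed.

Lemma level_path_prefix_opp v f p1 p2 (n := size (p1 ++ p2))
    (u := last f p1) :
    alternating_path_to E M v f (p1 ++ p2) -> level E M (odd n) v = Some n ->
    enat_lt (tenacity E M v) (tenacity E M u) ->
  enat_le (Some (size p1)) (level E M (~~ odd (size p1)) u).
Proof.
move=> pP p_min lt_t.
have Lu : level E M (odd (size p1)) u = Some (size p1).
  apply: (level_path_prefix pP p_min); move: lt_t; rewrite /enat_lt -/u.
  by case: tenacity => [a|]; case: tenacity => [c|] //=; lia.
move: lt_t; rewrite (tenacityE (odd (size p1)) u) Lu (tenacityE (odd n)) p_min.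
case Lm: (level E M (~~ odd (size p1)) u) => [m|] //=.
case Lr: (level E M (~~ odd n) v) => [k|] //=; rewrite /enat_lt /=.
have [h [r rP Er]] := level_ex Lr.
have v_p2 : v \in u :: p2.
  move: pP; rewrite alternating_path_toE last_cat => /and4P[_ _ _ /eqP <-].
  exact: mem_last.
have le_n : size p1 <= n by rewrite /n size_cat leq_addr.
(* If [size p1 <= k], then [n + k < size p1 + m] yields [size p1 <= n < m]; the other alternative
   contradicts this strict inequality. *)
case: (level_first_meeting pP p_min rP v_p2) => [le_r|[m']]; first by lia.
by rewrite -/u Lm => -[<-]; rewrite -/n; lia.
Qed.

End AlternatingPaths.

Theorem theorem5p2 (V : finType) (E M : {set {set V}})
    (hE : simple_graph E) (hM : matching E M)
    (v f : V) (p : seq V)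
    (hp : evenlevel_path E M v f p \/ oddlevel_path E M v f p)
    (u : V) (hu : u \in f :: p)
    (ht : enat_le (tenacity E M v) (tenacity E M u)) :
  BFS_honest E M f p u /\
  (enat_lt (tenacity E M v) (tenacity E M u) ->
     minlevel E M u = Some (prefix_length f p u)).
Proof.
have [pP p_min] :
    alternating_path_to E M v f p /\ level E M (odd (size p)) v = Some (size p).
  by case: hp => -[pP oddp p_min]; rewrite ?oddp ?(negPf oddp).
case/splitPl: p / hu => p1 p2 Eu in hp pP p_min *.
have Ei : prefix_length f (p1 ++ p2) u = size p1.
  move: pP; rewrite alternating_path_toE => /and4P[_ Up _ _].
  move: Up; rewrite /prefix_length -cat_cons lastI Eu cat_rcons => Up.
  rewrite -[size p1](size_belast f) index_cat /= eqxx addn0 ifN //.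
  by move: Up; rewrite cat_uniq /= negb_or => /and3P[_ /andP[]].
have Lu : level E M (odd (size p1)) u = Some (size p1).
  by rewrite -Eu; apply: (level_path_prefix pP p_min); rewrite Eu.
split; first by rewrite /BFS_honest Ei; case: odd Lu.
move=> lt_t; have : enat_le (Some (size p1)) (level E M (~~ odd (size p1)) u).
  by rewrite -Eu; apply: (level_path_prefix_opp pP p_min); rewrite Eu.
rewrite Ei /minlevel /evenlevel /oddlevel /enat_min.
(* [enat_min] returns the even level on a tie, so the odd case ends by antisymmetry. *)
case: (odd (size p1)) Lu => ->; rewrite /negb; last by move=> ->.
case: (level E M false u) => [m|] //= le_m.
by case: leqP => // le_m'; congr Some; apply/eqP; rewrite eqn_leq le_m' le_m.
Qed.
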